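(* Let $\psi\in L^2(\mathbb{R})$ satisfy $\widehat{\psi}(\xi)=0$ for $\xi<0$, and assume that $\psi$ is continuously differentiable with $\psi'\in L^2(\mathbb{R})$ and $\mathbf{T}\psi'\in L^2(\mathbb{R})$. Let $s\in L^2(\mathbb{R})$. Then, for all $x\in\mathbb{R}$ and $y\in\mathbb{R}^+$ satisfying $M_\psi^s(x,y)>0$, $$\nabla \log(M_\psi^s)(x,y)=\begin{pmatrix}0\\ \frac{1}{2y}\end{pmatrix}-\operatorname{Re}\begin{pmatrix}\dfrac{W_{\psi'}s(x,y)}{y\,W_\psi s(x,y)}\\[3mm] \dfrac{W_{(\mathbf{T}\psi)'}s(x,y)}{y\,W_\psi s(x,y)}\end{pmatrix}$$ and $$\nabla \phi_\psi^s(x,y)=-\operatorname{Im}\begin{pmatrix}\dfrac{W_{\psi'}s(x,y)}{y\,W_\psi s(x,y)}\\[3mm] \dfrac{W_{(\mathbf{T}\psi)'}s(x,y)}{y\,W_\psi s(x,y)}\end{pmatrix},$$ where $\nabla=(\partial/\partial x,\partial/\partial y)^{T}$.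
   Context: $\mathbb{R}^+=(0,\infty)$. The Fourier transform is $\widehat{f}(\xi)=\int_{\mathbb{R}}f(t)e^{-2\pi i\xi t}\,dt$ (extended to $L^2(\mathbb{R})$); conditions on $\widehat\psi$ are understood almost everywhere. For $s,\psi\in L^2(\mathbb{R})$ the continuous wavelet transform is $$W_\psi s(x,y)=\frac{1}{\sqrt{y}}\int_{\mathbb{R}}s(t)\,\overline{\psi\!\left(\frac{t-x}{y}\right)}\,dt,\qquad x\in\mathbb{R},\ y\in\mathbb{R}^+.$$ The operator $\mathbf{T}$ is time-weighting, $(\mathbf{T}f)(t)=t f(t)$; thus $\mathbf{T}\psi'$ is the function $t\mapsto t\psi'(t)$ and $(\mathbf{T}\psi)'=\psi+\mathbf{T}\psi'$. The magnitude is $M_\psi^s=|W_\psi s|$ and the phase is $\phi_\psi^s=\arg(W_\psi s)$, so that $\log(W_\psi s)=\log(M_\psi^s)+i\phi_\psi^s$ where $W_\psi s\neq0$; for the purpose of derivatives, $\phi_\psi^s$ is any locally defined continuous branch of the argument near a point where $W_\psi s\ne 0$. *)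

(* Defs.v *)
From HB Require Import structures.
From mathcomp Require Import all_boot all_order all_algebra.
From mathcomp Require Import complex.
From mathcomp Require Import all_classical all_reals all_analysis.

Set Implicit Arguments.
Unset Strict Implicit.
Unset Printing Implicit Defensive.

Import Order.TTheory GRing.Theory Num.Theory numFieldNormedType.Exports.

Local Open Scope classical_set_scope.
Local Open Scope ring_scope.
Local Open Scope complex_scope.

Section Wavelet.
Context {R : realType}.
Implicit Types (f g psi s : R -> R[i]) (x y t xi : R).

(* The modulus as an element of R: the norm `|z| of the library lives in R[i]. *)
Definition cmod (z : R[i]) : R := ComplexField.Normc.normc z.

Definition cis (theta : R) : R[i] := cos theta +i* sin theta.

Definition cintegral f : R[i] :=
  (\int[lebesgue_measure]_(t in setT) complex.Re (f t))%R +i*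
  (\int[lebesgue_measure]_(t in setT) complex.Im (f t))%R.

(* Elements of the complex L^p(R) are represented by Borel functions. *)
Definition cLp (p : \bar R) f : Prop :=
  [/\ measurable_fun [set: R] (fun t => complex.Re (f t)),
      measurable_fun [set: R] (fun t => complex.Im (f t)) &
      finite_norm lebesgue_measure p (fun t => cmod (f t))].

Definition cvgL2 (u : nat -> R -> R[i]) f : Prop :=
  'N[lebesgue_measure]_2%:E[EFin \o (fun t => cmod (u n t - f t)%R)]%E
    @[n --> \oo] --> 0%E.

Definition fourier f (xi : R) : R[i] :=
  cintegral (fun t => f t * cis (- (2 * pi * xi * t))).

(* g is a representative of the Fourier transform of f, extended from
   L^1 /\ L^2 to L^2 by continuity. *)
Definition is_fourierL2 f g : Prop :=
  cLp 2%:E g /\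
  exists u : nat -> R -> R[i],
    [/\ forall n, cLp 1%:E (u n) /\ cLp 2%:E (u n),
        cvgL2 u f &
        cvgL2 (fun n => fourier (u n)) g].

(* R[i] carries no normed R-module structure in the library, so differentiation
   with respect to a real variable is done on real and imaginary parts. *)
Definition cderive f (t : R) : R[i] :=
  derive1 (fun t => complex.Re (f t)) t +i* derive1 (fun t => complex.Im (f t)) t.

Definition cC1 f : Prop :=
  [/\ forall t, derivable (fun t => complex.Re (f t)) t 1,
      forall t, derivable (fun t => complex.Im (f t)) t 1,
      continuous (fun t => complex.Re (cderive f t)) &
      continuous (fun t => complex.Im (cderive f t))].

Definition time_weight f (t : R) : R[i] := t%:C * f t.

Definition cwt psi s (x y : R) : R[i] :=
  ((Num.sqrt y)^-1)%:C * cintegral (fun t => s t * (psi ((t - x) / y))^*).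

Definition magnitude psi s (x y : R) : R := cmod (cwt psi s x y).

(* phi is a continuous branch of arg (cwt psi s) on a neighbourhood
   of (x, y). *)
Definition local_phase psi s (x y : R) (phi : R -> R -> R) : Prop :=
  \forall q \near (x, y),
    {for q, continuous (fun r : R * R => phi r.1 r.2)} /\
    cwt psi s q.1 q.2 = (magnitude psi s q.1 q.2)%:C * cis (phi q.1 q.2).

Definition has_gradient (f : R -> R -> R) (x y : R) (g : R * R) : Prop :=
  is_derive x 1 (fun x' => f x' y) g.1 /\ is_derive y 1 (fun y' => f x y') g.2.

End Wavelet.

(* Main.v *)
Require Import Defs.
From mathcomp Require Import all_boot all_order all_algebra.
From mathcomp Require Import complex.
From mathcomp Require Import all_classical all_reals all_analysis.
From mathcomp Require Import measurable_realfun ring lra.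
Import Order.TTheory GRing.Theory Num.Theory numFieldNormedType.Exports.

Set Implicit Arguments.
Unset Strict Implicit.
Unset Printing Implicit Defensive.

Local Open Scope classical_set_scope.
Local Open Scope ring_scope.
Local Open Scope complex_scope.

(** Formally, differentiating the wavelet transform under the integral sign
    gives, with [W = W_psi s],

      [dW/dx = - y^-1 W_(psi') s]  and
      [dW/dy = (2 y)^-1 W - y^-1 W_((T psi)') s],

    the second one because [(T psi)' = psi + T psi'].  Since
    [log W = log |W| + i arg W], dividing by [W] and taking real and imaginary
    parts yields the two gradients.  What has to be justified is the
    differentiation under the integral.

    The difficulty is that [psi'] and [T psi'] are only square integrable and
    continuous: no single integrable function dominates the difference
    quotients.  Consider a pairing of [s] with a family [k p] whose derivative
    [g p] in the parameter [p] is continuous in [p].  By the fundamental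
    theorem of calculus the difference quotient of [k] is the average of [g]
    over the segment from [p] to [p + h], so that

      [|s (k (p + h) - k p) / h| <= (s ^ 2 + average of g ^ 2) / 2]

    (lemma [le_difference_quotient_average]).

    The right-hand side depends on [h], but as [h] tends to [0] it converges
    pointwise, by continuity of [g], and so does its integral: by Tonelli it
    involves only the average of [N p], the square of the L^2 norm of [g p],
    which for dilates and translates is an explicit continuous function of
    [p].  The dominated convergence theorem with a convergent sequence of
    dominating functions ([generalized_dominated_cvg], two applications of
    Fatou's lemma) then gives the derivative: this is [is_derive_L2_pairing].
    It is applied to [p |-> u ((t - p) / y)] and to [p |-> u ((t - x) / p)]
    for [u] the real and the imaginary part of [psi].

    The rest is calculus of one real variable.  For the phase,
    [sin (phi q - phi p)] is a differentiable function of [q] expressed by the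
    real and imaginary parts of [W], and continuity of [phi] allows the sine
    to be inverted near [p] ([is_derive_phase]). *)

(** * Dominated convergence with a varying dominating function *)

Section generalized_dominated_convergence.
Context d (T : measurableType d) (R : realType).
Variable mu : {measure set T -> \bar R}.

(** Fatou's lemma in the form of an eventual lower bound, in which it can be
    applied to two sequences and the bounds combined by linear arithmetic. *)
Lemma fatou_near (g_ : nat -> T -> R) (g : T -> R) :
  (forall n, mu.-integrable setT (EFin \o g_ n)) ->
  mu.-integrable setT (EFin \o g) ->
  (forall n t, 0 <= g_ n t) ->
  (forall t, g_ n t @[n --> \oo] --> g t) ->
  forall e, 0 < e ->
    \forall n \near \oo, \int[mu]_t g t - e < \int[mu]_t g_ n t.
Proof.
move=> ig_ ig g0 gg e e0.
have mg n : measurable_fun [set: T] (fun t => (g_ n t)%:E).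
  exact: (measurable_int mu (ig_ n)).
have g0' n t : setT t -> (0 <= (g_ n t)%:E)%E by rewrite lee_fin.
have := fatou mu measurableT mg g0'.
under eq_integral => t _.
  rewrite is_cvg_limn_einfE; last first.
    by apply/cvg_ex; exists (g t)%:E; apply/cvg_EFin; [exact: nearW|exact: gg].
  have /cvg_lim -> // : (g_ n t)%:E @[n --> \oo] --> (g t)%:E.
    by apply/cvg_EFin; [exact: nearW|exact: gg].
  over.
set u := fun n => (\int[mu]_t (g_ n t)%:E)%E.
have uE : limn (einfs u) = ereal_sup (range (einfs u)).
  by apply/cvg_lim => //; exact: cvg_einfs_sup.
rewrite limn_einf_lim uE => gle.
have : ((\int[mu]_t g t - e)%:E < \int[mu]_t (g t)%:E)%E.
  by rewrite -[ltRHS]fineK ?integrable_fin_num// lte_fin ltrBlDr ltrDl.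
move=> /lt_le_trans => /(_ _ gle) /ereal_sup_gt[_ [N _ <-] hN].
exists N => // n /= Nn; rewrite -lte_fin.
rewrite [X in (_ < X)%E]fineK ?integrable_fin_num//; last exact: ig_.
by apply: (lt_le_trans hN); apply: ereal_inf_lbound; exists n.
Qed.

(** Apply Fatou's lemma to the nonnegative functions [D_ n + f_ n] and
    [D_ n - f_ n]; since the integrals of [D_ n] converge to that of [D], this
    bounds the integrals of [f_ n] from below and from above. *)
Lemma generalized_dominated_cvg (f_ : nat -> T -> R) (f : T -> R)
    (D_ : nat -> T -> R) (D : T -> R) :
  (forall n, measurable_fun setT (f_ n)) -> measurable_fun setT f ->
  (forall n, mu.-integrable setT (EFin \o D_ n)) ->
  mu.-integrable setT (EFin \o D) ->
  (forall n t, `|f_ n t| <= D_ n t) ->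
  (forall t, f_ n t @[n --> \oo] --> f t) ->
  (forall t, D_ n t @[n --> \oo] --> D t) ->
  \int[mu]_t D_ n t @[n --> \oo] --> \int[mu]_t D t ->
  \int[mu]_t f_ n t @[n --> \oo] --> \int[mu]_t f t.
Proof.
move=> mf_ mf iD_ iD fD cf cD cID.
have if_ n : mu.-integrable setT (EFin \o f_ n).
  apply: (le_integrable measurableT _ _ (iD_ n)); first exact/measurable_EFinP.
  by move=> t _ /=; rewrite lee_fin (le_trans (fD n t))// ler_norm.
have fDt t : `|f t| <= D t.
  by apply: (ler_cvg_to (cvg_norm (cf t)) (cD t)); exact: nearW.
have iF : mu.-integrable setT (EFin \o f).
  apply: (le_integrable measurableT _ _ iD); first exact/measurable_EFinP.
  by move=> t _ /=; rewrite lee_fin (le_trans (fDt t))// ler_norm.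
apply/cvgrPdist_lt => e e0; have e2 : 0 < e / 2 by rewrite divr_gt0.
have lo := @fatou_near (fun n t => D_ n t + f_ n t) (fun t => D t + f t).
have hi := @fatou_near (fun n t => D_ n t - f_ n t) (fun t => D t - f t).
have {}lo : \forall n \near \oo,
    \int[mu]_t (D t + f t) - e / 2 < \int[mu]_t (D_ n t + f_ n t).
  apply: lo => //.
  - by move=> n; exact: (integrableD measurableT (iD_ n) (if_ n)).
  - exact: (integrableD measurableT iD iF).
  - move=> n t; rewrite -lerBlDl sub0r lerNl (le_trans _ (fD n t))//.
    by rewrite -normrN ler_norm.
  - by move=> t; exact: cvgD.
have {}hi : \forall n \near \oo,
    \int[mu]_t (D t - f t) - e / 2 < \int[mu]_t (D_ n t - f_ n t).
  apply: hi => //.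
  - by move=> n; exact: (integrableB measurableT (iD_ n) (if_ n)).
  - exact: (integrableB measurableT iD iF).
  - by move=> n t; rewrite subr_ge0 (le_trans _ (fD n t))// ler_norm.
  - by move=> t; exact: cvgB.
move/cvgrPdist_lt : cID => /(_ _ e2) cID.
near=> n.
have : \int[mu]_t (D t + f t) - e / 2 < \int[mu]_t (D_ n t + f_ n t) by near: n.
have : \int[mu]_t (D t - f t) - e / 2 < \int[mu]_t (D_ n t - f_ n t) by near: n.
have : `|\int[mu]_t D t - \int[mu]_t D_ n t| < e / 2 by near: n.
rewrite (RintegralB measurableT iD iF) (RintegralD measurableT iD iF).
rewrite (RintegralB measurableT (iD_ n) (if_ n)).
rewrite (RintegralD measurableT (iD_ n) (if_ n)).
by rewrite !ltr_norml => /andP[? ?] ? ?; apply/andP; split; lra.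
Unshelve. all: by end_near. Qed.

End generalized_dominated_convergence.

(** * Averages over a segment of parameters *)

Section average.
Variable R : realType.
Local Notation leb := (@lebesgue_measure R).

Lemma dist_path_le (p0 h theta : R) : theta \in `[0, 1] ->
  `|p0 + theta * h - p0| <= `|h|.
Proof.
rewrite in_itv/= => /andP[t0 t1]; rewrite addrAC subrr add0r normrM ger0_norm//.
by rewrite ler_piMl.
Qed.

Lemma continuous_path (phi : R -> R) (p0 h : R) :
  {in `[0, 1], forall theta, {for p0 + theta * h, continuous phi}} ->
  {within `[0, 1], continuous (fun theta => phi (p0 + theta * h))}.
Proof.
move=> cphi; apply: continuous_subspace_itv => theta theta01.
apply: continuous_comp; last exact: cphi.
by apply: cvgD; [exact: cvg_cst|apply: cvgM; [exact: cvg_id|exact: cvg_cst]].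
Qed.

Lemma integrable_path (phi : R -> R) (p0 h : R) :
  {in `[0, 1], forall theta, {for p0 + theta * h, continuous phi}} ->
  leb.-integrable `[0, 1] (fun theta => (phi (p0 + theta * h))%:E).
Proof.
move=> cphi; apply: continuous_compact_integrable; first exact: segment_compact.
exact: continuous_path.
Qed.

Lemma Rintegral_cst01 (c : R) : \int[leb]_(theta in `[0, 1]) c = c.
Proof.
rewrite Rintegral_cst//= lebesgue_measure_itv/= lte_fin ltr01.
by rewrite -EFinD/= subr0 mulr1.
Qed.

Lemma integrable_cst01 (c : R) : leb.-integrable `[0, 1] (fun=> c%:E).
Proof.
apply: continuous_compact_integrable; first exact: segment_compact.
by move=> x; exact: cvg_cst.
Qed.

(** Averaging over [theta] in [0, 1] instead of over the segment from [p0] to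
    [p0 + u n] avoids any distinction on the sign of [u n]. *)
Lemma cvg_average (phi : R -> R) (p0 r : R) (u : nat -> R) :
  (forall p, `|p - p0| < r -> {for p, continuous phi}) -> 0 < r ->
  (forall n, `|u n| < r) ->
  u n @[n --> \oo] --> 0 ->
  \int[leb]_(theta in `[0, 1]) phi (p0 + theta * u n) @[n --> \oo] --> phi p0.
Proof.
move=> cphi r0 ur u0.
have iphi n : leb.-integrable `[0, 1]
    (fun theta => (phi (p0 + theta * u n))%:E).
  apply: integrable_path => theta theta01; apply: cphi.
  exact: le_lt_trans (dist_path_le _ _ theta01) (ur n).
have cp0 : {for p0, continuous phi} by apply: cphi; rewrite subrr normr0.
apply/cvgrPdist_le => e e0.
have /cvgrPdist_le /(_ e e0) /nbhs_ballP[del /= del0 hdel] := cp0.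
move/cvgrPdist_lt : u0 => /(_ _ del0); apply: filterS => n.
rewrite sub0r normrN => und.
have iB : leb.-integrable `[0, 1]
    (EFin \o (fun theta => phi p0 - phi (p0 + theta * u n))).
  exact: (integrableB _ (integrable_cst01 _) (iphi n)).
rewrite -[phi p0]Rintegral_cst01 -RintegralB//;
  [|exact: integrable_cst01|exact: iphi].
rewrite (le_trans (le_normr_Rintegral _ iB))//.
rewrite -[leRHS]Rintegral_cst01; apply: le_Rintegral => //.
- exact: integrable_norm.
- exact: integrable_cst01.
- move=> theta theta01; apply: hdel; rewrite /ball/= distrC.
  by apply: le_lt_trans und; apply: dist_path_le.
Qed.

(** The difference quotient is the average [J] of [g], and the average of
    [(a + g) ^ 2] and of [(a - g) ^ 2] is nonnegative, whence
    [2 |a J| <= a ^ 2 + average of g ^ 2]. *)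
Lemma le_difference_quotient_average (k g : R -> R) (a p0 h : R) :
  h != 0 ->
  {in `[0, 1], forall theta,
    is_derive (p0 + theta * h) 1 k (g (p0 + theta * h))} ->
  {in `[0, 1], forall theta, {for p0 + theta * h, continuous g}} ->
  `|a * (h^-1 * (k (p0 + h) - k p0))| <=
  (a ^+ 2 + \int[leb]_(theta in `[0, 1]) g (p0 + theta * h) ^+ 2) / 2.
Proof.
move=> h0 dk cg.
have cg2 : {in `[0, 1], forall theta,
    {for p0 + theta * h, continuous (fun p : R => g p ^+ 2)}}.
  move=> theta theta01; apply: (@continuous_comp _ _ _ g (fun z => z ^+ 2)).
    exact: cg.
  exact: exprn_continuous.
have ig := integrable_path cg.
have ig2 := integrable_path cg2.
have dkp (theta : R) : theta \in `[0, 1] ->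
    is_derive theta 1 (fun th : R => k (p0 + th * h)) (g (p0 + theta * h) * h).
  move=> theta01; have dk' := dk _ theta01.
  have dp : is_derive theta 1 (fun th : R => p0 + th * h) h.
    by apply: is_derive_eq; rewrite /GRing.scale/=; ring.
  exact: is_derive1_comp.
have FTC : h^-1 * (k (p0 + h) - k p0) =
    \int[leb]_(theta in `[0, 1]) g (p0 + theta * h).
  have ckp (theta : R) : theta \in `[0, 1] ->
      {for theta, continuous (fun th : R => k (p0 + th * h))}.
    move=> theta01; have := dkp _ theta01.
    by move=> [/derivable1_diffP/differentiable_continuous].
  have := @continuous_FTC2 R (fun th : R => g (p0 + th * h) * h)
    (fun th : R => k (p0 + th * h)) 0 1 ltr01.
  rewrite mul0r mul1r addr0 => FTC.
  apply: (mulfI h0); rewrite mulrA mulfV// mul1r mulrC -RintegralZr//.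
  rewrite /Rintegral FTC//.
  - apply: continuous_subspace_itv => theta theta01.
    apply: cvgM; last exact: cvg_cst.
    apply: continuous_comp; last exact: cg.
    apply: cvgD; first exact: cvg_cst.
    by apply: cvgM; [exact: cvg_id|exact: cvg_cst].
  - split.
    + by move=> theta /subset_itv_oo_cc/dkp[].
    + by apply: cvg_at_right_filter; apply: ckp; rewrite in_itv/= lexx ler01.
    + by apply: cvg_at_left_filter; apply: ckp; rewrite in_itv/= lexx ler01.
  - by move=> theta /subset_itv_oo_cc/dkp d; rewrite derive1E derive_val.
have key (b : R) : b ^+ 2 = a ^+ 2 ->
    0 <= a ^+ 2 + \int[leb]_(theta in `[0, 1]) g (p0 + theta * h) ^+ 2 +
         2 * b * \int[leb]_(theta in `[0, 1]) g (p0 + theta * h).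
  move=> ba; rewrite -RintegralZl// -[a ^+ 2]Rintegral_cst01.
  have i1 : leb.-integrable `[0, 1]
      (EFin \o (fun theta : R => a ^+ 2 + g (p0 + theta * h) ^+ 2)).
    exact: (integrableD _ (integrable_cst01 _) ig2).
  have i2 : leb.-integrable `[0, 1]
      (EFin \o (fun theta : R => 2 * b * g (p0 + theta * h))).
    exact: (integrableZl _ _ ig).
  rewrite -RintegralD//; last exact: integrable_cst01.
  rewrite -RintegralD//; apply: Rintegral_ge0 => theta _ /=.
  rewrite -ba; set x := g _.
  suff -> : b ^+ 2 + x ^+ 2 + 2 * b * x = (b + x) ^+ 2 by exact: sqr_ge0.
  by ring.
rewrite FTC; have := key a erefl; have := key (- a) (sqrrN a).
set I := \int[_]_(_ in _) _; set J := \int[_]_(_ in _) _ => Hm Hp.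
by rewrite ler_norml; apply/andP; split; nra.
Qed.
End average.

(** * Differentiation of a pairing of square-integrable functions *)

Section pairing.
Context d (T : measurableType d) (R : realType).
Variable mu : {sigma_finite_measure set T -> \bar R}.
Local Notation leb := (@lebesgue_measure R).

Lemma integrable_fine_integral (f : T -> R) (c : R) :
  measurable_fun [set: T] f ->
  (forall t, 0 <= f t) -> (\int[mu]_t (f t)%:E = c%:E)%E ->
  mu.-integrable setT (EFin \o f) /\ \int[mu]_t f t = c.
Proof.
move=> mf f0 fc; split; last by rewrite /Rintegral fc.
apply/integrableP; split; first exact/measurable_EFinP.
by under eq_integral => t _ do rewrite /= ger0_norm//; rewrite fc ltry.
Qed.

(** Tonelli exchanges the average in [theta] with the integral of
    [g (p0 + theta * h) t ^+ 2] in [t], which is [N (p0 + theta * h)]. *)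
Lemma integral_average (g : R -> T -> R) (p0 h r : R) (N : R -> R) :
  `|h| < r ->
  measurable_fun [set: R * T] (fun z => g z.1 z.2) ->
  (forall p t, `|p - p0| < r -> {for p, continuous (g^~ t)}) ->
  (forall p, `|p - p0| < r -> (\int[mu]_t (g p t ^+ 2)%:E = (N p)%:E)%E) ->
  (forall p, `|p - p0| < r -> {for p, continuous N}) ->
  measurable_fun [set: T]
    (fun t => \int[leb]_(theta in `[0, 1]) g (p0 + theta * h) t ^+ 2) /\
  (\int[mu]_t (\int[leb]_(theta in `[0, 1]) g (p0 + theta * h) t ^+ 2)%:E =
  (\int[leb]_(theta in `[0, 1]) N (p0 + theta * h))%:E)%E.
Proof.
move=> hr mg cg gN cN.
have inr (theta : R) : theta \in `[0, 1] -> `|p0 + theta * h - p0| < r.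
  by move=> theta01; exact: le_lt_trans (dist_path_le _ _ theta01) hr.
(* The average over [0, 1] is written as an integral over the whole line in
   order to apply Tonelli's theorem. *)
pose f (z : T * R) := (g (p0 + z.2 * h) z.1 ^+ 2 * \1_(`[0, 1]%classic) z.2)%:E.
have mf : measurable_fun [set: T * R] f.
  apply/measurable_EFinP; apply: measurable_funM.
    apply: (measurableT_comp (f := fun x : R => x ^+ 2)).
      exact: exprn_measurable.
    apply: (measurableT_comp (f := fun z : R * T => g z.1 z.2)
      (g := fun z : T * R => (p0 + z.2 * h, z.1))) => //.
    apply: measurable_fun_pair => //.
    by apply: measurable_funD => //; exact: measurable_funM.
  by apply: measurableT_comp => //; exact: measurable_indic.
have f0 z : (0 <= f z)%E by rewrite lee_fin mulr_ge0// sqr_ge0.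
have fE t : (\int[leb]_theta f (t, theta) =
    (\int[leb]_(theta in `[0, 1]) g (p0 + theta * h) t ^+ 2)%:E)%E.
  have ig2 : leb.-integrable `[0, 1]
      (fun theta : R => (g (p0 + theta * h) t ^+ 2)%:E).
    apply: (@integrable_path R (fun p => g p t ^+ 2)) => theta theta01.
    apply: (@continuous_comp _ _ _ (g^~ t) (fun z => z ^+ 2)).
      exact/cg/inr.
    exact: exprn_continuous.
  rewrite [RHS]fineK; last exact: integrable_fin_num.
  rewrite integral_mkcond epatch_indic; apply: eq_integral => theta _.
  by rewrite /f EFinM.
have fE' : (fun t => (\int[leb]_(theta in `[0, 1])
    g (p0 + theta * h) t ^+ 2)%:E) = fubini_F leb f.
  by apply/funext => t; rewrite /fubini_F fE.
split.
  apply/measurable_EFinP; rewrite [X in measurable_fun _ X]fE'.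
  exact: measurable_fun_fubini_tonelli_F.
under eq_integral => t _ do rewrite -fE.
rewrite fubini_tonelli//.
have iN := @integrable_path R N p0 h
  (fun theta theta01 => cN _ (inr theta theta01)).
rewrite [RHS]fineK; last exact: integrable_fin_num.
rewrite [RHS]integral_mkcond epatch_indic; apply: eq_integral => theta _ /=.
case: (boolP (theta \in `[0, 1]%classic)) => [th01|/negbTE th01]; last first.
  rewrite indicE th01 mule0.
  under eq_integral => t _ do rewrite /f/= indicE th01 mulr0.
  exact: integral0.
rewrite indicE th01 mule1 -gN; last by move: th01; rewrite inE/=; exact: inr.
by apply: eq_integral => t _; rewrite /f/= indicE th01 mulr1.
Qed.

Lemma is_derive_quotient (F : R -> R) (p l : R) :
  (forall u : nat -> R, (forall n, u n != 0) -> u n @[n --> \oo] --> 0 ->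
    (u n)^-1 * (F (p + u n) - F p) @[n --> \oo] --> l) ->
  is_derive p 1 F l.
Proof.
move=> H.
have cv : h^-1 *: (F (h *: 1 + p) - F p) @[h --> 0^'] --> l.
  apply/cvgr_dnbhsP => u [u0 cu]; have := H u u0 cu.
  by apply: cvg_trans; apply: near_eq_cvg; apply: nearW => n;
     rewrite [u n *: 1]mulr1 [u n + p]addrC.
apply: DeriveDef; first by apply/cvg_ex; exists l.
exact/cvg_lim.
Qed.

(** The hypotheses on [N] replace a dominating function: continuity of the
    norms, together with pointwise continuity of [g], makes the dominating
    functions [D_ n] below converge in integral. *)
Lemma is_derive_L2_pairing (s : T -> R) (k g : R -> T -> R) (N : R -> R)
    (p0 r : R) :
  0 < r -> s \in Lfun mu 2%:E ->
  measurable_fun [set: R * T] (fun z => g z.1 z.2) ->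
  (forall p t, `|p - p0| < r -> is_derive p 1 (k^~ t) (g p t)) ->
  (forall p t, `|p - p0| < r -> {for p, continuous (g^~ t)}) ->
  (forall p, `|p - p0| < r ->
    mu.-integrable setT (fun t => (s t * k p t)%:E)) ->
  (forall p, `|p - p0| < r -> (\int[mu]_t (g p t ^+ 2)%:E = (N p)%:E)%E) ->
  (forall p, `|p - p0| < r -> {for p, continuous N}) ->
  is_derive p0 1 (fun p => \int[mu]_t (s t * k p t))
    (\int[mu]_t (s t * g p0 t)).
Proof.
move=> r0 sL mg dk cg isk gN cN; apply: is_derive_quotient => u u0 cu.
have [N0 _ uN0] : \forall n \near \oo, `|u n| < r.
  move/cvgrPdist_lt : cu => /(_ _ r0); apply: filterS => n.
  by rewrite sub0r normrN.
(* Dropping the first [N0] terms keeps every path within distance [r]. *)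
rewrite -(cvg_shiftn N0).
pose v n := u (n + N0)%N.
have vr n : `|v n| < r by apply: uN0; exact: leq_addl.
have cv : v n @[n --> \oo] --> 0 by rewrite (cvg_shiftn N0).
have p0r : `|p0 - p0| < r by rewrite subrr normr0.
have pvr n : `|p0 + v n - p0| < r by rewrite addrAC subrr add0r.
have inr n (theta : R) : theta \in `[0, 1] -> `|p0 + theta * v n - p0| < r.
  by move=> theta01; exact: le_lt_trans (dist_path_le _ _ theta01) (vr n).
have is2 : mu.-integrable setT (EFin \o (fun t => s t ^+ 2)).
  exact: Lfun2_integrable_sqr.
have ms : measurable_fun setT s by move: sL; rewrite inE => /andP[/[!inE]].
pose f_ n t := s t * ((v n)^-1 * (k (p0 + v n) t - k p0 t)).
pose J n t := \int[leb]_(theta in `[0, 1]) g (p0 + theta * v n) t ^+ 2.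
pose D_ n t := (s t ^+ 2 + J n t) / 2.
pose D t := (s t ^+ 2 + g p0 t ^+ 2) / 2.
have mgp p : measurable_fun [set: T] (g p).
  apply: (measurableT_comp (f := fun z : R * T => g z.1 z.2)
    (g := fun t : T => (p, t))) => //.
  exact: measurable_fun_pair.
have mg2 p : measurable_fun [set: T] (fun t => g p t ^+ 2).
  exact: measurable_funX.
have iJ n : mu.-integrable setT (EFin \o J n) /\
    \int[mu]_t J n t = \int[leb]_(theta in `[0, 1]) N (p0 + theta * v n).
  have [mJ IJ] := integral_average (vr n) mg cg gN cN.
  apply: integrable_fine_integral => //.
  by move=> t; apply: Rintegral_ge0 => theta _; exact: sqr_ge0.
have ig2 : mu.-integrable setT (EFin \o (fun t => g p0 t ^+ 2)) /\
    \int[mu]_t (g p0 t ^+ 2) = N p0.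
  apply: integrable_fine_integral => //; last exact: gN.
  by move=> t; exact: sqr_ge0.
have halfD (G : T -> R) : mu.-integrable setT (EFin \o G) ->
    mu.-integrable setT (EFin \o (fun t => (s t ^+ 2 + G t) / 2)) /\
    \int[mu]_t ((s t ^+ 2 + G t) / 2) =
    (\int[mu]_t (s t ^+ 2) + \int[mu]_t G t) / 2.
  move=> iG.
  have iD : mu.-integrable setT (EFin \o (fun t => s t ^+ 2 + G t)).
    exact: (integrableD measurableT is2 iG).
  split; last by rewrite RintegralZr// RintegralD.
  exact: (integrableZr measurableT 2^-1 iD).
have iskB n := integrableB measurableT (isk _ (pvr n)) (isk _ p0r).
have isf n : mu.-integrable setT (EFin \o f_ n).
  have := integrableZl measurableT (v n)^-1 (iskB n).
  apply: eq_integrable => // t _ /=; rewrite -EFinB -EFinM /f_.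
  by congr EFin; ring.
have fE n : (u (n + N0)%N)^-1 *
    (\int[mu]_t (s t * k (p0 + u (n + N0)%N) t) - \int[mu]_t (s t * k p0 t)) =
    \int[mu]_t f_ n t.
  rewrite -/(v n) -RintegralB//; [|exact: isk|exact: isk].
  rewrite -RintegralZl//; last exact: iskB.
  by apply: eq_Rintegral => t _; rewrite /f_; ring.
under eq_fun do rewrite fE.
apply: (@generalized_dominated_cvg _ _ _ _ f_ _ D_ D).
- by move=> n; apply/measurable_EFinP; exact: (measurable_int mu (isf n)).
- exact: measurable_funM.
- by move=> n; apply: (halfD _ _).1; exact: (iJ n).1.
- by apply: (halfD _ _).1; exact: ig2.1.
- move=> n t; apply: (@le_difference_quotient_average _ (k^~ t) (g^~ t)).
  + exact: u0.
  + by move=> theta theta01; apply: dk; exact: inr.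
  + by move=> theta theta01; apply: cg; exact: inr.
- move=> t; apply: cvgM; first exact: cvg_cst.
  have dkt := dk _ t p0r.
  have : h^-1 *: (k (h *: 1 + p0) t - k p0 t) @[h --> 0^'] --> g p0 t.
    by have [dk1 <-] := dkt; exact: dk1.
  move/cvgr_dnbhsP => /(_ v (conj (fun n => u0 _) cv)); apply: cvg_trans.
  apply: near_eq_cvg; apply: nearW => n.
  by rewrite [v n *: 1]mulr1 [v n + p0]addrC.
- move=> t; apply: cvgM; last exact: cvg_cst.
  apply: cvgD; first exact: cvg_cst.
  apply: (@cvg_average _ (fun p => g p t ^+ 2) p0 r) => //.
  move=> p pr; apply: (@continuous_comp _ _ _ (g^~ t) (fun z => z ^+ 2)).
    exact: cg.
  exact: exprn_continuous.
- rewrite (halfD _ ig2.1).2 ig2.2.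
  under eq_fun => n do rewrite (halfD _ (iJ n).1).2 (iJ n).2.
  apply: cvgM; last exact: cvg_cst.
  apply: cvgD; first exact: cvg_cst.
  exact: (@cvg_average _ N p0 r).
Qed.
End pairing.

(** * Translates and dilates of square-integrable functions *)

Lemma Lfun2_sqr_integral d (T : measurableType d) (R : realType)
    (mu : {measure set T -> \bar R}) (f : T -> R) :
  measurable_fun [set: T] f -> (\int[mu]_t (f t ^+ 2)%:E < +oo)%E ->
  f \in Lfun mu 2%:E.
Proof.
move=> mf f2; rewrite inE; apply/andP; split; rewrite inE//=.
rewrite /finite_norm unlock; apply: poweR_lty.
under eq_integral => t _.
  rewrite /= ?poweR_EFin (powR_mulrn 2)// -normrX ger0_norm ?sqr_ge0//.
  over.
exact: f2.
Qed.

Lemma measurable_inv (R : realType) : measurable_fun [set: R] (@GRing.inv R).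
Proof.
have -> : [set: R] = [set x | x != 0] `|` [set 0].
  by apply/seteqP; split=> x _ //=; case: (eqVneq x 0); [right|left].
apply/measurable_funU => //; first by apply: open_measurable; exact: open_neq.
split; last exact: measurable_fun_set1.
apply: open_continuous_measurable_fun; first exact: open_neq.
by move=> x; rewrite inE/= => x0; exact: inv_continuous.
Qed.

Lemma is_derive_continuous (R : realType) (u du : R -> R) :
  (forall t : R, is_derive t 1 u (du t)) -> continuous u.
Proof.
by move=> du' t; have [/derivable1_diffP/differentiable_continuous] := du' t.
Qed.

Section square_integrable.
Context d (T : measurableType d) (R : realType).
Variable mu : {measure set T -> \bar R}.
Implicit Types u v : T -> R.

Lemma Lfun2N u : u \in Lfun mu 2%:E -> (fun t => - u t) \in Lfun mu 2%:E.
Proof.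
move=> Lu; apply: Lfun2_sqr_integral.
  by apply: measurableT_comp => //; move: Lu; rewrite inE => /andP[/[!inE]].
under eq_integral do rewrite sqrrN.
have /integrableP[_] := Lfun2_integrable_sqr Lu.
by under eq_integral => t _ do rewrite /= ger0_norm ?sqr_ge0//.
Qed.

Lemma Lfun2D u v : u \in Lfun mu 2%:E -> v \in Lfun mu 2%:E ->
  (fun t => u t + v t) \in Lfun mu 2%:E.
Proof.
have p1 : (1 <= 2%:E :> \bar R)%E by rewrite lee_fin ler1n.
have [_ LD] := Lfun_addr_closed mu p1.
exact: LD.
Qed.
End square_integrable.

Section dilation.
Variable R : realType.
Local Notation leb := (@lebesgue_measure R).

Lemma ge0_integral_dilation (G : R -> R) (x y : R) : 0 < y ->
  continuous G -> (forall t, 0 <= G t) ->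
  (\int[leb]_t (G ((t - x) / y))%:E = y%:E * \int[leb]_t (G t)%:E)%E.
Proof.
move=> y0 cG G0; pose F (t : R) := (t - x) / y.
have dF (t : R) : is_derive t 1 F y^-1.
  by apply: is_derive_eq; rewrite /GRing.scale/=; ring.
have F'E : F^`()%classic = cst y^-1.
  by apply/funext => t; rewrite derive1E derive_val.
rewrite [in RHS](@increasing_ge0_integration_by_substitutionT _ F G)//.
- rewrite -ge0_integralZl//=; last 3 first.
  + apply/measurable_EFinP; apply: measurable_funM; last by rewrite F'E.
    apply: continuous_measurable_fun => t.
    apply: continuous_comp; last exact: cG.
    exact: is_derive_continuous dF t.
  + move=> t _; rewrite lee_fin; apply: mulr_ge0; first exact: G0.
    by rewrite F'E/= invr_ge0 ltW.
  + by rewrite lee_fin ltW.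
  apply: eq_integral => t _; rewrite -EFinM F'E/= mulrCA.
  by rewrite [y * y^-1]mulfV ?gt_eqF// mulr1.
- by move=> a b ab; rewrite /F ltr_pM2r ?invr_gt0// ltrD2r.
- by rewrite F'E => t; exact: cvg_cst.
- by rewrite F'E; exact: is_cvg_cst.
- by rewrite F'E; exact: is_cvg_cst.
- apply: gt0_cvgMlNy; first by rewrite invr_gt0.
  apply/cvgrNyPlt => M; near=> t; rewrite ltrBlDr; near: t.
  exact: nbhs_ninfty_lt.
- apply: gt0_cvgMly; first by rewrite invr_gt0.
  apply/cvgryPgt => M; near=> t; rewrite ltrBrDr; near: t.
  exact: nbhs_pinfty_gt.
Unshelve. all: by end_near. Qed.

Lemma sqr_integral_dilation (G : R -> R) (x y : R) : 0 < y ->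
  continuous G -> G \in Lfun leb 2%:E ->
  (\int[leb]_t (G ((t - x) / y) ^+ 2)%:E = (y * \int[leb]_t (G t ^+ 2))%:E)%E.
Proof.
move=> y0 cG LG; rewrite (@ge0_integral_dilation (fun t => G t ^+ 2))//.
- rewrite EFinM; congr (_ * _)%E; rewrite fineK//.
  by apply: integrable_fin_num => //; exact: Lfun2_integrable_sqr.
- move=> t; apply: (@continuous_comp _ _ _ G (fun z => z ^+ 2)).
    exact: cG.
  exact: exprn_continuous.
- by move=> t; exact: sqr_ge0.
Qed.

Lemma continuous_dilation (G : R -> R) (x y : R) : continuous G ->
  continuous (fun t => G ((t - x) / y)).
Proof.
move=> cG t; apply: continuous_comp; last exact: cG.
apply: cvgM; last exact: cvg_cst.
by apply: cvgB; [exact: cvg_id|exact: cvg_cst].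
Qed.

Lemma Lfun2_dilation (G : R -> R) (x y : R) : 0 < y ->
  continuous G -> G \in Lfun leb 2%:E ->
  (fun t => G ((t - x) / y)) \in Lfun leb 2%:E.
Proof.
move=> y0 cG LG; apply: Lfun2_sqr_integral; last by rewrite sqr_integral_dilation// ltry.
by apply: continuous_measurable_fun; exact: continuous_dilation.
Qed.

Lemma integrable_mul_dilation (s G : R -> R) (x y : R) : 0 < y ->
  s \in Lfun leb 2%:E -> continuous G -> G \in Lfun leb 2%:E ->
  leb.-integrable setT (fun t => (s t * G ((t - x) / y))%:E).
Proof.
move=> y0 Ls cG LG.
apply/(Lfun1_integrable leb (fun t : R => s t * G ((t - x) / y))).
exact: (Lfun2_mul_Lfun1 Ls (Lfun2_dilation x y0 cG LG)).
Qed.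

Section derivative.
Variables s u du : R -> R.
Hypotheses (Ls : s \in Lfun leb 2%:E) (Lu : u \in Lfun leb 2%:E).
Hypothesis dudt : forall t : R, is_derive t 1 u (du t).
Hypothesis cdu : continuous du.

Let cu : continuous u.
Proof. exact: is_derive_continuous dudt. Qed.

Let measurable_arg (f : R * R -> R) (G : R -> R) : continuous G ->
  measurable_fun setT f -> measurable_fun setT (fun z => G (f z)).
Proof.
move=> cG mf; apply: measurableT_comp => //.
exact: continuous_measurable_fun.
Qed.

(** The squared norm of the derivative [- y^-1 * du ((t - p) / y)] does not
    depend on the position [p]. *)
Lemma is_derive_translation (x y : R) : 0 < y -> du \in Lfun leb 2%:E ->
  is_derive x 1 (fun p => \int[leb]_t (s t * u ((t - p) / y)))
    (- y^-1 * \int[leb]_t (s t * du ((t - x) / y))).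
Proof.
move=> y0 Ldu; rewrite -RintegralZl//; last exact: integrable_mul_dilation.
under [X in is_derive _ _ _ X]eq_Rintegral do rewrite mulrCA.
apply: (@is_derive_L2_pairing _ _ R leb s (fun p t : R => u ((t - p) / y))
  (fun p t : R => - y^-1 * du ((t - p) / y))
  (fun=> y^-1 ^+ 2 * (y * \int[leb]_t (du t ^+ 2))) x 1) => //.
- apply: measurable_funM => //; apply: measurable_arg => //.
  by apply: measurable_funM => //; exact: measurable_funB.
- move=> p t _; rewrite mulrC; apply: is_derive1_comp.
  by apply: is_derive_eq; rewrite /GRing.scale/=; ring.
- move=> p t _; apply: cvgM; first exact: cvg_cst.
  apply: continuous_comp; last exact: cdu.
  apply: cvgM; last exact: cvg_cst.
  by apply: cvgB; [exact: cvg_cst|exact: cvg_id].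
- by move=> p _; exact: integrable_mul_dilation.
- move=> p _; under eq_integral => t _ do rewrite exprMn sqrrN EFinM.
  rewrite ge0_integralZl//.
  + by rewrite sqr_integral_dilation.
  + apply/measurable_EFinP; apply: measurable_funX.
    by apply: continuous_measurable_fun; exact: continuous_dilation.
  + by move=> t _; rewrite lee_fin sqr_ge0.
  + by rewrite lee_fin sqr_ge0.
- by move=> p _; exact: cvg_cst.
Qed.

(** With [v = (t - x) / p], the derivative in the scale [p] is [- p^-1] times
    [v * du v]: this is where the time-weighted derivative enters.  Its squared
    norm is proportional to [p^-1]. *)
Lemma is_derive_dilation (x y : R) : 0 < y ->
  (fun t => t * du t) \in Lfun leb 2%:E ->
  is_derive y 1 (fun p => \int[leb]_t (s t * u ((t - x) / p)))
    (- y^-1 * \int[leb]_t (s t * ((t - x) / y * du ((t - x) / y)))).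
Proof.
set Tdu := fun t => t * du t => y0 LTdu.
have cT : continuous Tdu by move=> t; apply: cvgM; [exact: cvg_id|exact: cdu].
have iT : leb.-integrable setT (fun t => (s t * Tdu ((t - x) / y))%:E).
  exact: integrable_mul_dilation.
rewrite -RintegralZl//.
under [X in is_derive _ _ _ X]eq_Rintegral do rewrite mulrCA.
have pos (p : R) : `|p - y| < y -> 0 < p.
  by rewrite ltr_norml => /andP[]; rewrite ltrBrDr addNr.
have cinv (p : R) : 0 < p -> {for p, continuous (@GRing.inv R)}.
  by move=> p0; apply: inv_continuous; rewrite gt_eqF.
apply: (@is_derive_L2_pairing _ _ R leb s (fun p t : R => u ((t - x) / p))
  (fun p t : R => - p^-1 * Tdu ((t - x) / p))
  (fun p => p^-1 ^+ 2 * (p * \int[leb]_t (Tdu t ^+ 2))) y y) => //.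
- have mV : measurable_fun setT (fun z : R * R => z.1^-1).
    by apply: measurableT_comp => //; exact: measurable_inv.
  apply: measurable_funM; first exact: measurableT_comp.
  apply: measurable_arg => //; apply: measurable_funM => //.
  exact: measurable_funB.
- move=> p t /pos p0.
  have -> : - p^-1 * Tdu ((t - x) / p) =
      du ((t - x) / p) * ((t - x) * - p ^- 2).
    by rewrite /Tdu; field; rewrite gt_eqF.
  apply: is_derive1_comp.
  have pn0 : p != 0 by rewrite gt_eqF.
  have dV : is_derive p 1 (fun q : R => q^-1) (- p ^- 2 *: 1).
    exact: (@is_deriveV R id p 1 1 pn0).
  by apply: is_derive_eq; rewrite /GRing.scale/=; ring.
- move=> p t /pos p0; apply: cvgM; first by apply: cvgN; exact: cinv.
  apply: (@continuous_comp _ _ _ (fun q : R => (t - x) / q) Tdu);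
    last exact: cT.
  by apply: cvgM; [exact: cvg_cst|exact: cinv].
- by move=> p /pos p0; exact: integrable_mul_dilation.
- move=> p /pos p0; under eq_integral => t _ do rewrite exprMn sqrrN EFinM.
  rewrite ge0_integralZl//.
  + by rewrite sqr_integral_dilation.
  + apply/measurable_EFinP; apply: measurable_funX.
    by apply: continuous_measurable_fun; exact: continuous_dilation.
  + by move=> t _; rewrite lee_fin sqr_ge0.
  + by rewrite lee_fin sqr_ge0.
- move=> p /pos p0; apply: cvgM.
    apply: (@continuous_comp _ _ _ (@GRing.inv R) (fun z => z ^+ 2)).
      exact: cinv.
    exact: exprn_continuous.
  by apply: cvgM; [exact: cvg_id|exact: cvg_cst].
Qed.
End derivative.
End dilation.

(** * Derivatives of the log-modulus and of the argument *)

Section calculus.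
Variable R : realType.
Implicit Types (A B phi : R -> R) (p a b c : R).

Lemma is_derive_hypot A B p a b :
  is_derive p 1 A a -> is_derive p 1 B b -> 0 < A p ^+ 2 + B p ^+ 2 ->
  is_derive p 1 (fun q => Num.sqrt (A q ^+ 2 + B q ^+ 2))
    ((A p * a + B p * b) / Num.sqrt (A p ^+ 2 + B p ^+ 2)).
Proof.
move=> dA dB M0; pose M2 (q : R) := A q ^+ 2 + B q ^+ 2.
have dM2 : is_derive p 1 M2 (2 * (A p * a + B p * b)).
  by apply: is_derive_eq; rewrite /GRing.scale/=; ring.
have S0 : Num.sqrt (M2 p) != 0 by rewrite gt_eqF// sqrtr_gt0.
apply: is_derive_eq.
  exact: (@is_derive1_comp R Num.sqrt M2 p _ _ (is_derive1_sqrt M0) dM2).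
by rewrite -/(M2 p); field.
Qed.

Lemma is_derive_ln_hypot A B p a b :
  is_derive p 1 A a -> is_derive p 1 B b -> 0 < A p ^+ 2 + B p ^+ 2 ->
  is_derive p 1 (fun q => ln (Num.sqrt (A q ^+ 2 + B q ^+ 2)))
    ((A p * a + B p * b) / (A p ^+ 2 + B p ^+ 2)).
Proof.
move=> dA dB M0; pose S (q : R) := Num.sqrt (A q ^+ 2 + B q ^+ 2).
have S0 : 0 < S p by rewrite sqrtr_gt0.
apply: is_derive_eq.
  exact: (@is_derive1_comp R (@ln R) S p _ _ (is_derive1_ln S0)
    (is_derive_hypot dA dB M0)).
rewrite -[in RHS](sqr_sqrtr (ltW M0)) -/(S p).
by field; rewrite gt_eqF.
Qed.

(** The function [S q = sin (phi q - phi p)] is rational in [A], [B] and their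
    modulus, hence differentiable; as [phi] is continuous, [phi q - phi p] stays
    in the range where [asin] inverts the sine, and [asin] has derivative [1]
    at [S p = 0]. *)
Lemma is_derive_phase A B phi p a b :
  is_derive p 1 A a -> is_derive p 1 B b -> 0 < A p ^+ 2 + B p ^+ 2 ->
  {for p, continuous phi} ->
  (\forall q \near p, A q = Num.sqrt (A q ^+ 2 + B q ^+ 2) * cos (phi q) /\
                      B q = Num.sqrt (A q ^+ 2 + B q ^+ 2) * sin (phi q)) ->
  is_derive p 1 phi ((A p * b - B p * a) / (A p ^+ 2 + B p ^+ 2)).
Proof.
move=> dA dB M0 cphi polar.
pose M q := Num.sqrt (A q ^+ 2 + B q ^+ 2).
have Mp0 : 0 < M p by rewrite sqrtr_gt0.
have dM : is_derive p 1 M _ := is_derive_hypot dA dB M0.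
have cM : {for p, continuous M}.
  by have [/derivable1_diffP/differentiable_continuous] := dM.
pose S q := (B q * A p - A q * B p) * (M q * M p)^-1.
have MM0 : M p * M p != 0 by rewrite mulf_neq0// gt_eqF.
have Sp : S p = 0 by rewrite /S mulrC [A p * _]mulrC subrr mulr0.
have dS : is_derive p 1 S ((A p * b - B p * a) / (A p ^+ 2 + B p ^+ 2)).
  have dV : is_derive p 1 (fun q => (M q * M p)^-1)
      (- (M p * M p) ^- 2 *: (M p * ((A p * a + B p * b) / M p))).
    apply: (@is_deriveV R (fun q => M q * M p) p) => //.
    by apply: is_derive_eq; rewrite /GRing.scale/=; ring.
  apply: is_derive_eq; rewrite /GRing.scale/= -(sqr_sqrtr (ltW M0)) -/(M p).
  by field; rewrite gt_eqF.
have dasin : is_derive p 1 (fun q => phi p + asin (S q))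
    ((A p * b - B p * a) / (A p ^+ 2 + B p ^+ 2)).
  have d0 : is_derive (S p) 1 (@asin R) 1.
    rewrite Sp; apply: is_derive_eq; first by apply: is_derive1_asin; lra.
    by rewrite expr0n/= subr0 sqrtr1 invr1.
  by apply: is_derive_eq; rewrite add0r !mul1r.
apply: near_eq_is_derive dasin.
have [Ap Bp] : A p = M p * cos (phi p) /\ B p = M p * sin (phi p).
  exact: nbhs_singleton polar.
have small : \forall q \near p, `|phi p - phi q| < pi / 2.
  by move/cvgrPdist_lt : cphi; apply; rewrite divr_gt0// pi_gt0.
have Mq0 : \forall q \near p, 0 < M q.
  exact: (cvgr_gt (M p) cM).
near=> q.
have [Aq Bq] : A q = M q * cos (phi q) /\ B q = M q * sin (phi q) by near: q.
have Sq : S q = sin (phi q - phi p).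
  rewrite /S sinB Aq Bq Ap Bp.
  have q0 : 0 < M q by near: q.
  by field; rewrite !gt_eqF.
rewrite Sq sinK; first by rewrite addrC subrK.
have : `|phi p - phi q| < pi / 2 by near: q.
by rewrite distrC ltr_norml in_itv/= => /andP[/ltW-> /ltW->].
Unshelve. all: by end_near. Qed.

Lemma Re_mul (z w : R[i]) : complex.Re (z * w) =
  complex.Re z * complex.Re w - complex.Im z * complex.Im w.
Proof. by case: z => ? ?; case: w. Qed.

Lemma Im_mul (z w : R[i]) : complex.Im (z * w) =
  complex.Re z * complex.Im w + complex.Im z * complex.Re w.
Proof. by case: z => ? ?; case: w. Qed.

(** If [W' = c W - y^-1 V] with [c] real then [W' / W = c - V / (y W)], whose
    real and imaginary parts are the derivatives of [log |W|] and [arg W].  Both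
    partial derivatives of the wavelet transform have this form, with [c = 0]
    for the position and [c = (2 y)^-1] for the scale. *)
Lemma log_derivatives (W : R -> R[i]) (V : R[i]) p c y :
  0 < y -> 0 < cmod (W p) ->
  is_derive p 1 (fun q => complex.Re (W q))
    (c * complex.Re (W p) - y^-1 * complex.Re V) ->
  is_derive p 1 (fun q => complex.Im (W q))
    (c * complex.Im (W p) - y^-1 * complex.Im V) ->
  is_derive p 1 (fun q => ln (cmod (W q)))
    (c - complex.Re (V / (y%:C * W p))) /\
  (forall phi, {for p, continuous phi} ->
    (\forall q \near p, W q = (cmod (W q))%:C * cis (phi q)) ->
    is_derive p 1 phi (- complex.Im (V / (y%:C * W p)))).
Proof.
move=> y0 W0 dRe dIm.
have cmodE z : cmod z = Num.sqrt (complex.Re z ^+ 2 + complex.Im z ^+ 2) :> R.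
  by case: z.
have M0 : 0 < complex.Re (W p) ^+ 2 + complex.Im (W p) ^+ 2.
  by move: W0; rewrite cmodE sqrtr_gt0.
have ReIm : complex.Re (V / (y%:C * W p)) =
      (complex.Re V * complex.Re (W p) + complex.Im V * complex.Im (W p)) /
      (y * (complex.Re (W p) ^+ 2 + complex.Im (W p) ^+ 2)) /\
    complex.Im (V / (y%:C * W p)) =
      (complex.Im V * complex.Re (W p) - complex.Re V * complex.Im (W p)) /
      (y * (complex.Re (W p) ^+ 2 + complex.Im (W p) ^+ 2)).
  have Wn : W p != 0.
    by apply/eqP => Wp; move: M0; rewrite Wp/= expr0n addr0 ltxx.
  have yn : y%:C != 0 :> R[i] by rewrite (inj_eq (@complexI _)) gt_eqF.
  have : V / (y%:C * W p) * (y%:C * W p) = V by rewrite divfK// mulf_neq0.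
  case: (V / _) => u v; case: (W p) M0 => a b /= M0 VE.
  have ab0 := lt0r_neq0 M0; have yn0 := lt0r_neq0 y0.
  by rewrite -VE /=; split; field; rewrite ab0 yn0.
have [-> ->] := ReIm; split.
  under eq_fun do rewrite cmodE.
  apply: is_derive_eq; first exact: is_derive_ln_hypot.
  by field; rewrite !gt_eqF.
move=> phi cphi polar; apply: is_derive_eq.
  apply: (is_derive_phase dRe dIm M0 cphi).
  apply: filterS polar => q; rewrite -cmodE => Wq; split.
    by rewrite [in LHS]Wq Re_mul/= mul0r subr0.
  by rewrite [in LHS]Wq Im_mul/= mul0r addr0.
by field; rewrite !gt_eqF.
Qed.
End calculus.

(** * Partial derivatives of the wavelet transform *)

Section cwt.
Variable R : realType.
Local Notation leb := (@lebesgue_measure R).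
Implicit Types (f psi s : R -> R[i]) (u v : R -> R) (x y t : R).
Local Notation Re := (@complex.Re R).
Local Notation Im := (@complex.Im R).

Lemma cLp2_Lfun f : cLp 2%:E f ->
  (fun t => Re (f t)) \in Lfun leb 2%:E /\
  (fun t => Im (f t)) \in Lfun leb 2%:E.
Proof.
move=> [mRe mIm fin2].
have cmod2 t : cmod (f t) ^+ 2 = Re (f t) ^+ 2 + Im (f t) ^+ 2.
  rewrite /cmod; case: (f t) => a b /=.
  by rewrite sqr_sqrtr// addr_ge0// sqr_ge0.
have mcmod : measurable_fun [set: R] (fun t => cmod (f t)).
  rewrite (_ : (fun t => cmod (f t)) =
      (fun t => Num.sqrt (Re (f t) ^+ 2 + Im (f t) ^+ 2))); last first.
    by apply/funext => t; rewrite /cmod; case: (f t).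
  apply: (measurableT_comp (f := @Num.sqrt R)).
    by apply: continuous_measurable_fun; exact: sqrt_continuous.
  by apply: measurable_funD; apply: measurable_funX.
have Lcmod : (fun t => cmod (f t)) \in Lfun leb 2%:E.
  by rewrite inE; apply/andP; split; rewrite inE.
have icmod := Lfun2_integrable_sqr Lcmod.
have sub u : measurable_fun [set: R] u ->
    (forall t, u t ^+ 2 <= cmod (f t) ^+ 2) -> u \in Lfun leb 2%:E.
  move=> mu ule; apply: Lfun2_sqr_integral => //.
  have : leb.-integrable setT (EFin \o (fun t => u t ^+ 2)).
    apply: (le_integrable measurableT _ _ icmod).
      by apply/measurable_EFinP; exact: measurable_funX.
    by move=> t _ /=; rewrite lee_fin !ger0_norm ?sqr_ge0.
  move/integrableP => [_]; apply: le_lt_trans.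
  rewrite le_eqVlt; apply/orP; left.
  by apply/eqP; apply: eq_integral => t _ /=; rewrite ger0_norm ?sqr_ge0.
by split; apply: sub => // t; rewrite cmod2 ?lerDl ?lerDr sqr_ge0.
Qed.

Definition dilated_pairing (s u : R -> R) (x y : R) : R :=
  \int[leb]_t (s t * u ((t - x) / y)).

Lemma dilated_pairingD (s u v : R -> R) x y : 0 < y -> s \in Lfun leb 2%:E ->
  continuous u -> u \in Lfun leb 2%:E -> continuous v -> v \in Lfun leb 2%:E ->
  dilated_pairing s (fun t => u t + v t) x y =
  dilated_pairing s u x y + dilated_pairing s v x y.
Proof.
move=> y0 Ls cu Lu cv Lv; rewrite /dilated_pairing -RintegralD//.
- by apply: eq_Rintegral => t _; rewrite mulrDr.
- exact: integrable_mul_dilation.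
- exact: integrable_mul_dilation.
Qed.

(** The real and the imaginary part of the transform are both of this form,
    for [(s1, s2) = (Re s, Im s)] and [(s1, s2) = (Im s, - Re s)] respectively,
    so that they can be differentiated together. *)
Definition cwt_component (s1 s2 u1 u2 : R -> R) x y : R :=
  (Num.sqrt y)^-1 * (dilated_pairing s1 u1 x y + dilated_pairing s2 u2 x y).

Lemma Re_Im_cwt psi s x y : 0 < y ->
  (fun t => Re (s t)) \in Lfun leb 2%:E ->
  (fun t => Im (s t)) \in Lfun leb 2%:E ->
  (fun t => Re (psi t)) \in Lfun leb 2%:E ->
  (fun t => Im (psi t)) \in Lfun leb 2%:E ->
  continuous (fun t => Re (psi t)) -> continuous (fun t => Im (psi t)) ->
  Re (cwt psi s x y) =
    cwt_component (fun t => Re (s t)) (fun t => Im (s t))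
      (fun t => Re (psi t)) (fun t => Im (psi t)) x y /\
  Im (cwt psi s x y) =
    cwt_component (fun t => Im (s t)) (fun t => - Re (s t))
      (fun t => Re (psi t)) (fun t => Im (psi t)) x y.
Proof.
move=> y0 Ls1 Ls2 Lp1 Lp2 c1 c2.
rewrite /cwt Re_mul Im_mul /cwt_component /dilated_pairing /=.
rewrite !mul0r subr0 addr0; split; congr (_ * _).
- rewrite -RintegralD//; [|exact: (integrable_mul_dilation x y0 Ls1 c1 Lp1)
                          |exact: (integrable_mul_dilation x y0 Ls2 c2 Lp2)].
  apply: eq_Rintegral => t _; rewrite Re_mul.
  by case: (psi _) => a b /=; rewrite mulrN opprK.
- have LN1 : (fun t => - Re (s t)) \in Lfun leb 2%:E by exact: Lfun2N.
  rewrite -RintegralD//; [|exact: (integrable_mul_dilation x y0 Ls2 c1 Lp1)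
                          |exact: (integrable_mul_dilation x y0 LN1 c2 Lp2)].
  apply: eq_Rintegral => t _; rewrite Im_mul.
  by case: (psi _) => a b /=; rewrite mulrN mulNr addrC.
Qed.

Lemma cderive_time_weight psi t :
  (forall t, derivable (fun t => Re (psi t)) t 1) ->
  (forall t, derivable (fun t => Im (psi t)) t 1) ->
  Re (cderive (time_weight psi) t) = Re (psi t) + t * Re (cderive psi t) /\
  Im (cderive (time_weight psi) t) = Im (psi t) + t * Im (cderive psi t).
Proof.
move=> d1 d2.
have ReT : (fun t => Re (time_weight psi t)) = (fun t => t * Re (psi t)).
  by apply/funext => u; rewrite /time_weight Re_mul/= mul0r subr0.
have ImT : (fun t => Im (time_weight psi t)) = (fun t => t * Im (psi t)).
  by apply/funext => u; rewrite /time_weight Im_mul/= mul0r addr0.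
have dT (u : R -> R) : derivable u t 1 ->
    derive1 (fun t => t * u t) t = u t + t * derive1 u t.
  move=> du; have du' : is_derive t 1 u (derive1 u t).
    by apply: DeriveDef => //; rewrite derive1E.
  rewrite derive1E; apply: derive_val.
  by apply: is_derive_eq; rewrite /GRing.scale/= mulr1 addrC.
by rewrite /cderive ReT ImT /= !dT.
Qed.

Section gradient.
Variables s1 s2 u1 u2 du1 du2 : R -> R.
Hypotheses (Ls1 : s1 \in Lfun leb 2%:E) (Ls2 : s2 \in Lfun leb 2%:E).
Hypotheses (Lu1 : u1 \in Lfun leb 2%:E) (Lu2 : u2 \in Lfun leb 2%:E).
Hypothesis dudt1 : forall t, is_derive t 1 u1 (du1 t).
Hypothesis dudt2 : forall t, is_derive t 1 u2 (du2 t).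
Hypotheses (cdu1 : continuous du1) (cdu2 : continuous du2).

Lemma is_derive_cwt_component_position x y : 0 < y ->
  du1 \in Lfun leb 2%:E -> du2 \in Lfun leb 2%:E ->
  is_derive x 1 (fun p => cwt_component s1 s2 u1 u2 p y)
    (0 * cwt_component s1 s2 u1 u2 x y -
     y^-1 * cwt_component s1 s2 du1 du2 x y).
Proof.
move=> y0 Ldu1 Ldu2.
have d1 := is_derive_translation Ls1 Lu1 dudt1 cdu1 x y0 Ldu1.
have d2 := is_derive_translation Ls2 Lu2 dudt2 cdu2 x y0 Ldu2.
apply: is_derive_eq.
by rewrite /cwt_component /dilated_pairing /GRing.scale/=; ring.
Qed.

(** The factor [1 / sqrt y] contributes [- (2 y)^-1] to the logarithmic
    derivative; writing [T u'] as [(T u)' - u] turns it into [+ (2 y)^-1]. *)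
Lemma is_derive_cwt_component_scale x y : 0 < y ->
  (fun t => t * du1 t) \in Lfun leb 2%:E ->
  (fun t => t * du2 t) \in Lfun leb 2%:E ->
  is_derive y 1 (fun q => cwt_component s1 s2 u1 u2 x q)
    ((2 * y)^-1 * cwt_component s1 s2 u1 u2 x y -
     y^-1 * cwt_component s1 s2 (fun t => u1 t + t * du1 t)
              (fun t => u2 t + t * du2 t) x y).
Proof.
move=> y0 Ldu1 Ldu2.
have d1 := is_derive_dilation Ls1 Lu1 dudt1 cdu1 x y0 Ldu1.
have d2 := is_derive_dilation Ls2 Lu2 dudt2 cdu2 x y0 Ldu2.
have cu1 := is_derive_continuous dudt1.
have cu2 := is_derive_continuous dudt2.
have contT (du : R -> R) : continuous du -> continuous (fun t : R => t * du t).
  by move=> c t; apply: cvgM; [exact: cvg_id|exact: c].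
have S0 : 0 < Num.sqrt y by rewrite sqrtr_gt0.
have dS := is_derive1_sqrt y0.
have dSV : is_derive y 1 (fun q => (Num.sqrt q)^-1)
    (- (2 * y)^-1 * (Num.sqrt y)^-1).
  apply: is_derive_eq.
    exact: (@is_deriveV R (@Num.sqrt R) y _ _ (lt0r_neq0 S0)).
  rewrite /GRing.scale/= -[in RHS](sqr_sqrtr (ltW y0)).
  rewrite [in X in _ = _ * X]sqrtr_sqr.
  rewrite (ger0_norm (ltW S0)).
  by field; rewrite lt0r_neq0.
apply: is_derive_eq.
rewrite /cwt_component !dilated_pairingD//; try exact: contT.
rewrite /dilated_pairing /GRing.scale/=.
by field; rewrite !lt0r_neq0.
Qed.
End gradient.
End cwt.

Theorem theorem1 (R : realType) (psi psihat s : R -> R[i]) (x y : R)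
  (psi_L2 : cLp 2%:E psi)
  (psihatE : is_fourierL2 psi psihat)
  (psihat_neg : {ae lebesgue_measure, forall xi : R, xi < 0 -> psihat xi = 0})
  (psi_C1 : cC1 psi)
  (dpsi_L2 : cLp 2%:E (cderive psi))
  (Tdpsi_L2 : cLp 2%:E (time_weight (cderive psi)))
  (s_L2 : cLp 2%:E s)
  (y_gt0 : 0 < y)
  (M_gt0 : 0 < magnitude psi s x y) :
  let ax := cwt (cderive psi) s x y / (y%:C * cwt psi s x y) in
  let ay := cwt (cderive (time_weight psi)) s x y / (y%:C * cwt psi s x y) in
  has_gradient (fun x' y' => ln (magnitude psi s x' y')) x y
    (0 - complex.Re ax, (2 * y)^-1 - complex.Re ay) /\
  (forall phi : R -> R -> R, local_phase psi s x y phi ->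
    has_gradient phi x y (- complex.Im ax, - complex.Im ay)).
Proof.
move=> ax ay.
have [dReP dImP cdRe cdIm] := psi_C1.
have isd (u : R -> R) : (forall t : R, derivable u t 1) ->
    forall t : R, is_derive t 1 u (derive1 u t).
  by move=> du t; apply: DeriveDef => //; rewrite derive1E.
have [Ls1 Ls2] := cLp2_Lfun s_L2.
have LNs1 := Lfun2N Ls1.
have [Lp1 Lp2] := cLp2_Lfun psi_L2.
have [Ld1 Ld2] := cLp2_Lfun dpsi_L2.
have dp1 : forall t : R, is_derive t 1 (fun t => complex.Re (psi t))
    (complex.Re (cderive psi t)) := isd _ dReP.
have dp2 : forall t : R, is_derive t 1 (fun t => complex.Im (psi t))
    (complex.Im (cderive psi t)) := isd _ dImP.
have cp1 := is_derive_continuous dp1.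
have cp2 := is_derive_continuous dp2.
have TE (t : R) :
    complex.Re (time_weight (cderive psi) t) = t * complex.Re (cderive psi t) /\
    complex.Im (time_weight (cderive psi) t) = t * complex.Im (cderive psi t).
  by rewrite /time_weight Re_mul Im_mul/= !mul0r subr0 addr0.
have [LT1 LT2] := cLp2_Lfun Tdpsi_L2.
have {}LT1 : (fun t => t * complex.Re (cderive psi t))
    \in Lfun lebesgue_measure 2%:E.
  by move: LT1; under eq_fun => t do rewrite (TE t).1.
have {}LT2 : (fun t => t * complex.Im (cderive psi t))
    \in Lfun lebesgue_measure 2%:E.
  by move: LT2; under eq_fun => t do rewrite (TE t).2.
have cT (u du : R -> R) : continuous u -> continuous du ->
    continuous (fun t : R => u t + t * du t).
  move=> cu cdu t; apply: cvgD; first exact: cu.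
  by apply: cvgM; [exact: cvg_id|exact: cdu].
have DT1 : (fun t => complex.Re (cderive (time_weight psi) t)) =
    (fun t => complex.Re (psi t) + t * complex.Re (cderive psi t)).
  by apply/funext => t; exact: (cderive_time_weight _ dReP dImP).1.
have DT2 : (fun t => complex.Im (cderive (time_weight psi) t)) =
    (fun t => complex.Im (psi t) + t * complex.Im (cderive psi t)).
  by apply/funext => t; exact: (cderive_time_weight _ dReP dImP).2.
have psiE x' y' (y'0 : 0 < y') := Re_Im_cwt x' y'0 Ls1 Ls2 Lp1 Lp2 cp1 cp2.
have dpsiE := Re_Im_cwt x y_gt0 Ls1 Ls2 Ld1 Ld2 cdRe cdIm.
have := @Re_Im_cwt _ (cderive (time_weight psi)) s x y y_gt0 Ls1 Ls2.
rewrite DT1 DT2 => /(_ (Lfun2D Lp1 LT1) (Lfun2D Lp2 LT2)) TpsiE.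
have {}TpsiE := TpsiE (cT _ _ cp1 cdRe) (cT _ _ cp2 cdIm).
have [lnx phix] :
  is_derive x 1 (fun x' => ln (magnitude psi s x' y)) (0 - complex.Re ax) /\
  (forall phi, {for x, continuous phi} ->
    (\forall x' \near x,
      cwt psi s x' y = (magnitude psi s x' y)%:C * cis (phi x')) ->
    is_derive x 1 phi (- complex.Im ax)).
  apply: log_derivatives => //.
  - under eq_fun do rewrite (psiE _ _ y_gt0).1.
    rewrite (psiE _ _ y_gt0).1 dpsiE.1.
    exact: is_derive_cwt_component_position.
  - under eq_fun do rewrite (psiE _ _ y_gt0).2.
    rewrite (psiE _ _ y_gt0).2 dpsiE.2.
    exact: is_derive_cwt_component_position.
have [lny phiy] :
  is_derive y 1 (fun y' => ln (magnitude psi s x y'))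
    ((2 * y)^-1 - complex.Re ay) /\
  (forall phi, {for y, continuous phi} ->
    (\forall y' \near y,
      cwt psi s x y' = (magnitude psi s x y')%:C * cis (phi y')) ->
    is_derive y 1 phi (- complex.Im ay)).
  (* The components agree with the transform only at positive scales. *)
  have ypos : \forall q \near y, 0 < q by exact: lt_nbhsr.
  apply: log_derivatives => //.
  - rewrite (psiE _ _ y_gt0).1 TpsiE.1.
    apply: near_eq_is_derive (is_derive_cwt_component_scale Ls1 Ls2 Lp1 Lp2
      dp1 dp2 cdRe cdIm x y_gt0 LT1 LT2).
    by apply: filterS ypos => q q0; rewrite (psiE _ _ q0).1.
  - rewrite (psiE _ _ y_gt0).2 TpsiE.2.
    apply: near_eq_is_derive (is_derive_cwt_component_scale Ls2 LNs1 Lp1 Lp2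
      dp1 dp2 cdRe cdIm x y_gt0 LT1 LT2).
    by apply: filterS ypos => q q0; rewrite (psiE _ _ q0).2.
split; first by rewrite /has_gradient /=; exact: (conj lnx lny).
move=> phi loc.
have hx : (x', y) @[x' --> x] --> (x, y).
  move=> P [[A B] /= [Ax By] AB]; apply: filterS Ax => x' Ax'.
  by apply: AB; split => //=; exact: nbhs_singleton By.
have hy : (x, y') @[y' --> y] --> (x, y).
  move=> P [[A B] /= [Ax By] AB]; apply: filterS By => y' By'.
  by apply: AB; split => //=; exact: nbhs_singleton Ax.
have [cphi _] := nbhs_singleton loc.
split.
- apply: phix.
    exact: (cvg_comp _ (fun r : R * R => phi r.1 r.2) hx cphi).
  have nearx : \forall x' \near x,
      {for (x', y), continuous (fun r : R * R => phi r.1 r.2)} /\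
      cwt psi s x' y = (magnitude psi s x' y)%:C * cis (phi x' y) := hx _ loc.
  by apply: filterS nearx => x' [].
- apply: phiy.
    exact: (cvg_comp _ (fun r : R * R => phi r.1 r.2) hy cphi).
  have neary : \forall y' \near y,
      {for (x, y'), continuous (fun r : R * R => phi r.1 r.2)} /\
      cwt psi s x y' = (magnitude psi s x y')%:C * cis (phi x y') := hy _ loc.
  by apply: filterS neary => y' [].
Qed.
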